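(* Let $n\ge 1$ and let $\mathcal{T}_n$ be the TSSCPP poset. The order of rowmotion $\mathrm{row}$ as a permutation of $J(\mathcal{T}_n)$ is divisible by $3n-2$.
   Context: The TSSCPP poset $\mathcal{T}_n$ has elements $(i;a,b)$ with $1\le i\le n-1$ and $1\le a<b\le i+1$ (layer $i$ is a copy of $\Phi^+(A_i)$, $(i;a,b)$ corresponding to $e_a-e_b$). Its order is the reflexive-transitive closure of: within layer $i$, $(i;a,b)$ covers $(i;a+1,b)$ and $(i;a,b-1)$ whenever $b-a\ge 2$; between layers, $(i;a,b)$ is covered by $(i+1;a,b)$. $J(\mathcal{T}_n)$ is its set of order ideals. Rowmotion: $\mathrm{row}(I)$ is the order ideal generated by the minimal elements of $\mathcal{T}_n\setminus I$.
   Formalization: The case n = 2 is excluded: there the poset has one element, rowmotion swaps its two order ideals and has order 2, which is not divisible by 3n − 2 = 4, so the claim as stated fails. *)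

(* Defs.v *)
From HB Require Import structures.
From mathcomp Require Import all_boot all_order all_fingroup.
From mathcomp Require Import cyclic zify.

Set Implicit Arguments.
Unset Strict Implicit.
Unset Printing Implicit Defensive.

Import Order.TTheory.

Section OrderIdeals.
Context {d : Order.disp_t} {T : finPOrderType d}.
Implicit Types A : {set T}.

Definition is_order_ideal A :=
  [forall x in A, forall y, (y <= x)%O ==> (y \in A)].

Record order_ideal := OrderIdeal {
  ideal_set :> {set T};
  _ : is_order_ideal ideal_set }.

HB.instance Definition _ := [isSub for ideal_set].
HB.instance Definition _ := [Finite of order_ideal by <:].

Definition min_elts A := [set x in A | [forall y in A, (y <= x)%O ==> (y == x)]].

Definition ideal_gen A := [set x | [exists y in A, (x <= y)%O]].

Lemma order_idealP (I : order_ideal) x y :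
  (y <= x)%O -> x \in ideal_set I -> y \in ideal_set I.
Proof.
case: I => A /= /forall_inP idA le_yx xA.
by have /forallP/(_ y)/implyP := idA x xA; apply.
Qed.

Lemma ideal_gen_ideal A : is_order_ideal (ideal_gen A).
Proof.
apply/forall_inP => x; rewrite inE => /exists_inP[z zA le_xz].
apply/forallP => y; apply/implyP => le_yx; rewrite inE.
by apply/exists_inP; exists z => //; apply: le_trans le_xz.
Qed.

Definition rowmotion (I : order_ideal) : order_ideal :=
  OrderIdeal (ideal_gen_ideal (min_elts (~: I))).

Lemma ex_min_elts A x : x \in A -> exists2 y, y \in min_elts A & (y <= x)%O.
Proof.
have [m] := ubnP #|[set z in A | (z <= x)%O]|.
elim: m x => // m IHm x le_m xA.
have [minx|] := boolP (x \in min_elts A); first by exists x.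
rewrite inE xA /= => /forall_inPn[y yA]; rewrite negb_imply => /andP[le_yx ne_yx].
have [||z z_min le_zy] := IHm y => //; last by exists z => //; apply: le_trans le_yx.
rewrite -ltnS; apply: leq_trans le_m; rewrite ltnS; apply: proper_card.
apply/properP; split.
  by apply/subsetP => z; rewrite !inE => /andP[-> /le_trans ->].
exists x; first by rewrite !inE xA lexx.
rewrite !inE xA /=; apply: contra ne_yx => le_xy.
by rewrite eq_le le_yx.
Qed.

Lemma min_elts_sub_gen A B :
  ideal_gen (min_elts A) = ideal_gen (min_elts B) -> min_elts A \subset min_elts B.
Proof.
move=> eqAB; apply/subsetP => x xA.
have: x \in ideal_gen (min_elts B).
  by rewrite -eqAB inE; apply/exists_inP; exists x.
rewrite inE => /exists_inP[y yB le_xy].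
have: y \in ideal_gen (min_elts A).
  by rewrite eqAB inE; apply/exists_inP; exists y.
rewrite inE => /exists_inP[z zA le_yz].
suff -> : x = y by [].
move: (zA); rewrite inE => /andP[_ /forall_inP/(_ x)].
have xA' : x \in A by move: xA; rewrite inE => /andP[].
move=> /(_ xA')/implyP/(_ (le_trans le_xy le_yz))/eqP eq_xz.
by apply: le_anti; rewrite le_xy eq_xz le_yz.
Qed.

Lemma rowmotion_inj : injective rowmotion.
Proof.
have sub (I J : order_ideal) : rowmotion I = rowmotion J -> J \subset I.
  move=> /(congr1 ideal_set)/= eqIJ; apply/subsetP => x xJ.
  apply: contraT => xI.
  have [|y y_min le_yx] := @ex_min_elts (~: I) x; first by rewrite inE.
  move/(subsetP (min_elts_sub_gen eqIJ)): y_min; rewrite !inE => /andP[/negP[]].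
  exact: order_idealP le_yx xJ.
move=> I J eqIJ; apply: val_inj; apply/eqP; rewrite eqEsubset.
by rewrite !sub.
Qed.

Definition rowmotion_perm : {perm order_ideal} := perm rowmotion_inj.

End OrderIdeals.

Arguments order_ideal {d} T.
Arguments rowmotion {d} T I.
Arguments rowmotion_perm {d} T.

(* The triple (i, a, b) stands for the element (i; a, b). The ordinal bounds are
   no extra restriction: i <= n - 1 is i < n, and a < b <= i + 1 <= n. *)
Definition tsscpp_triple (n : nat) (x : 'I_n * 'I_n.+1 * 'I_n.+1) : bool :=
  let: (i, a, b) := x in [&& 1 <= i, 1 <= a, a < b & b <= i.+1].

Record tsscpp (n : nat) := TSSCPP {
  tsscpp_val :> 'I_n * 'I_n.+1 * 'I_n.+1;
  _ : tsscpp_triple tsscpp_val }.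

HB.instance Definition _ n := [isSub for @tsscpp_val n].
HB.instance Definition _ n := [Finite of tsscpp n by <:].

(* [tsscpp_cover x y]: y covers x. *)
Definition tsscpp_cover (n : nat) (x y : tsscpp n) : bool :=
  let: (i, a, b) := tsscpp_val x in
  let: (j, c, e) := tsscpp_val y in
  [&& i == j :> nat, 2 <= e - c
    & (a == c.+1 :> nat) && (b == e :> nat) ||
      (a == c :> nat) && (b == e.-1 :> nat)]
  || [&& j == i.+1 :> nat, a == c :> nat & b == e :> nat].

(* [connect] is the reflexive-transitive closure. *)
Definition tsscpp_le (n : nat) : rel (tsscpp n) := connect (@tsscpp_cover n).

Section TsscppOrder.
Variable n : nat.

Let rk (x : tsscpp n) : nat :=
  let: (i, a, b) := tsscpp_val x in i + (b - a).

Lemma tsscpp_cover_rk x y : tsscpp_cover x y -> rk x < rk y.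
Proof.
case: x y => [[[i a] b] /= ix] [[[j c] e] /= jy].
by rewrite /tsscpp_cover /rk /=; move: ix jy => /=; lia.
Qed.

Lemma tsscpp_le_rk x y : tsscpp_le x y -> x = y \/ rk x < rk y.
Proof.
move=> /connectP[p]; elim: p x => [|z p IHp] x /=; first by left.
move=> /andP[/tsscpp_cover_rk lt_xz] /IHp {}IHp /IHp[<-|lt_zy]; first by right.
by right; apply: ltn_trans lt_zy.
Qed.

Lemma tsscpp_le_anti : antisymmetric (@tsscpp_le n).
Proof.
move=> x y /andP[/tsscpp_le_rk[//|lt_xy] /tsscpp_le_rk[//|lt_yx]].
by move: (ltn_trans lt_xy lt_yx); rewrite ltnn.
Qed.

Lemma tsscpp_le_refl : reflexive (@tsscpp_le n).
Proof. exact: connect0. Qed.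

Lemma tsscpp_le_trans : transitive (@tsscpp_le n).
Proof. exact: connect_trans. Qed.

End TsscppOrder.

Fact tsscpp_display : Order.disp_t. Proof. exact: Order.Disp tt tt. Qed.

HB.instance Definition _ n := @Order.Le_isPOrder.Build tsscpp_display (tsscpp n)
  (@tsscpp_le n) (@tsscpp_le_refl n) (@tsscpp_le_anti n) (@tsscpp_le_trans n).

(* The poset for n = 2 has a single element, so rowmotion there swaps the two
   order ideals: its order is not divisible by 3 * 2 - 2 = 4, whence the
   exclusion of n = 2 in the main statement. *)
Lemma tsscpp2_rowmotion_order : #[rowmotion_perm (tsscpp 2)]%g = 2.
Proof.
have all_eq (x y : tsscpp 2) : x = y.
  apply: val_inj; case: x y => [[[i a] b] /= ix] [[[j c] e] /= jy].
  have [lti ltj] := (ltn_ord i, ltn_ord j).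
  by congr (_, _, _); apply: val_inj; move: ix jy => /=; lia.
have x0 : tsscpp 2.
  have x0P : @tsscpp_triple 2 (inord 1, inord 1, inord 2) by rewrite /= !inordK.
  exact: TSSCPP x0P.
have memR (I : order_ideal (tsscpp 2)) x :
    (x \in (rowmotion _ I : {set _})) = (x \notin (I : {set _})).
  rewrite inE; apply/exists_inP/idP => [[y]|xI].
    by rewrite !inE (all_eq y x) => /andP[].
  exists x; rewrite ?lexx // !inE xI /=.
  by apply/forall_inP => z _; rewrite (all_eq z x) eqxx implybT.
apply: nt_prime_order => //.
  apply/permP => I; rewrite expgS expg1 permM !permE.
  apply: val_inj; apply/setP => x.
  by rewrite [LHS]memR memR negbK.
apply/eqP => /permP eq1.
have id0 : is_order_ideal (set0 : {set tsscpp 2}).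
  by apply/forall_inP => x; rewrite inE.
have /(congr1 ideal_set)/setP/(_ x0) := eq1 (OrderIdeal id0).
by rewrite !permE [LHS]memR /= !inE.
Qed.

(* Main.v *)
Require Import Defs.
From mathcomp Require Import all_boot all_order all_fingroup.
From mathcomp Require Import zify.

Set Implicit Arguments.
Unset Strict Implicit.
Unset Printing Implicit Defensive.

Import Order.TTheory.

(** The rowmotion orbit of the empty ideal has exactly [3n - 2] elements when
    [n >= 3], which forces [3n - 2] to divide the order of the permutation. The
    orbit can be written down explicitly. For [0 <= k <= 3n - 3] the element
    [(i;a,b)] lies in the [k]-th ideal iff either [k >= n - 1 + i + (b - a)], or
    [i + b - 2a <= k <= n - 2 + a] and, in addition, [i + (b - a) < n], or
    [i + (b - a) = n] and [k] has the parity of [i + b]. The last of these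
    ideals is the whole poset, which rowmotion sends back to the empty ideal,
    and each [k] in [1 .. 3n - 3] has [(1;1,2)] or [(2;2,3)] in its ideal. *)

(** Reduced modulo [m], the order of [s] leaves an iterate with exponent below [m] that fixes [x],
    so the remainder is zero. *)
Lemma order_perm_dvdn (T : finType) (s : {perm T}) (x : T) (m : nat) :
  0 < m -> iter m s x = x -> (forall k, 0 < k < m -> iter k s x != x) ->
  m %| #[s]%g.
Proof.
move=> m0 itm free.
have its q : iter (q * m) s x = x.
  by elim: q => // q IHq; rewrite mulSn iterD IHq.
have : iter #[s]%g s x = x by rewrite -permX expg_order perm1.
rewrite {1}(divn_eq #[s]%g m) addnC iterD its => /eqP itr.
rewrite /dvdn; apply: contraLR itr; rewrite -lt0n => r0.
by rewrite free // r0 ltn_mod.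
Qed.

(** * Rowmotion through cover relations *)

Section RowmotionByCovers.
Context {d : Order.disp_t} {T : finPOrderType d} (cover : rel T).
Hypothesis le_connect : forall x y : T, (x <= y)%O = connect cover x y.
Hypothesis cover_lt : forall x y : T, cover x y -> (x < y)%O.
Implicit Types (I J : order_ideal T) (A : {set T}).

Lemma lt_lower_cover (x y : T) :
  (x < y)%O -> exists2 z, cover z y & (x <= z)%O.
Proof.
rewrite lt_neqAle le_connect => /andP[ne_xy /connectP[p]].
case/lastP: p => [|p z] /=; first by move=> _ eq_yx; rewrite eq_yx eqxx in ne_xy.
rewrite rcons_path last_rcons => /andP[xp cz] ->.
by exists (last x p) => //; rewrite le_connect; apply/connectP; exists p.
Qed.

(** Everything strictly below [x] lies below a lower cover of [x], and [I] is down-closed, so lower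
    covers suffice. *)
Lemma min_elts_setC I (x : T) :
  (x \in min_elts (~: I)) =
  (x \notin (I : {set T})) && [forall y, cover y x ==> (y \in (I : {set T}))].
Proof.
rewrite !inE; case xI: (x \in _) => //=; apply/forall_inP/forallP => [minx y|low y].
  apply/implyP => cyx; apply: contraT => yI.
  have := cover_lt cyx; rewrite lt_neqAle => /andP[ne_yx le_yx].
  by rewrite (implyP (minx y _) le_yx) ?inE in ne_yx.
rewrite inE => yI; apply/implyP => le_yx; apply: contraNT yI => ne_yx.
have [|z czx le_yz] := @lt_lower_cover y x; first by rewrite lt_neqAle ne_yx.
exact: order_idealP le_yz (implyP (low z) czx).
Qed.

Lemma cover_closed_ideal A :
  (forall x y, cover x y -> y \in A -> x \in A) -> is_order_ideal A.
Proof.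
move=> Acl; apply/forall_inP => y yA; apply/forallP => x; apply/implyP.
rewrite le_connect => /connectP[p]; elim: p x => [|z p IHp] x /=; first by move=> _ <-.
by move=> /andP[cxz zp] lst; apply: Acl cxz (IHp _ zp lst).
Qed.

(** The first premise puts the generators of the new ideal in [J]; the second makes every maximal
    element of [J] such a generator. *)
Lemma rowmotionP I J :
  (forall x, x \notin (I : {set T}) ->
     (forall y, cover y x -> y \in (I : {set T})) -> x \in (J : {set T})) ->
  (forall x, x \in (J : {set T}) ->
     (forall y, cover x y -> y \notin (J : {set T})) ->
     x \notin (I : {set T}) /\ forall y, cover y x -> y \in (I : {set T})) ->
  rowmotion T I = J.
Proof.
move=> birth top; apply: val_inj; apply/setP => x; rewrite inE.
apply/exists_inP/idP => [[y]|].
  rewrite min_elts_setC => /andP[yI /forallP low] le_xy.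
  by apply: order_idealP le_xy (birth y yI _) => z; apply/implyP.
(* Climb along covers inside [J] to a maximal element; the up-set shrinks at each step. *)
have [m] := ubnP #|[set z | (x <= z)%O]|; elim: m x => // m IHm x le_m xJ.
have [/existsP[y /andP[cxy yJ]]|/existsPn noup] :=
    boolP [exists y, cover x y && (y \in (J : {set T}))].
  have lt_xy := cover_lt cxy.
  have [||z zmin le_yz] := IHm y; last 1 first.
  - by exists z => //; apply: le_trans (ltW lt_xy) le_yz.
  - rewrite ltnS in le_m; apply: leq_trans le_m; apply: proper_card.
    apply/properP; split.
      by apply/subsetP => z; rewrite !inE; apply/le_trans/ltW.
    by exists x; rewrite !inE ?lexx ?(lt_geF lt_xy).
  - by [].
exists x; last exact: lexx.
have [|xI low] := top x xJ.
  by move=> y cxy; have := noup y; rewrite cxy.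
by rewrite min_elts_setC xI; apply/forallP => y; apply/implyP/low.
Qed.

End RowmotionByCovers.

(** * Arithmetic of the explicit orbit *)

Definition orbit_mem (n k i a b : nat) : bool :=
  [&& i + b <= k + a + a, k.+1 < n + a
    & (i + b < n + a) || (i + b == n + a) && ~~ odd (i + b + k)]
  || (n + i + b <= k.+1 + a).

Lemma orbit_mem_incr_a n k i a b : orbit_mem n k i a b -> orbit_mem n k i a.+1 b.
Proof. by rewrite /orbit_mem; lia. Qed.

Lemma orbit_mem_decr_b n k i a b : orbit_mem n k i a b.+1 -> orbit_mem n k i a b.
Proof. by rewrite /orbit_mem; lia. Qed.

Lemma orbit_mem_decr_i n k i a b : orbit_mem n k i.+1 a b -> orbit_mem n k i a b.
Proof. by rewrite /orbit_mem; lia. Qed.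

(** Arithmetic form of the first premise of [rowmotionP]; each guard says when that lower cover
    exists. *)
Lemma orbit_mem_birth n k i a b :
  k.+1 < 3 * n - 2 -> i < n -> [&& 1 <= i, 1 <= a, a < b & b <= i.+1] ->
  ~~ orbit_mem n k i a b ->
  (a.+1 < b -> orbit_mem n k i a.+1 b) ->
  (a.+1 < b -> orbit_mem n k i a b.-1) ->
  (b <= i -> orbit_mem n k i.-1 a b) ->
  orbit_mem n k.+1 i a b.
Proof.
move=> ltk; case: i => // i; case: a => // a; case: b => // b /= lti abi.
(* All parities reduce to that of [i + b + k]; the splits compare [i + (b - a)] with [n] and decide
   which lower covers exist. *)
rewrite /orbit_mem !(addSn, addnS) /=.
case E : (odd _); have [h|h|h] := ltngtP (i + b).+2 (n + a).+1;
  have [h'|h'] := leqP b i; have [h2|h2] := leqP b a.+1; lia.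
Qed.

(** Arithmetic form of the second premise, with guards for the upper covers too. *)
Lemma orbit_mem_top n k i a b :
  k.+1 < 3 * n - 2 -> i < n -> [&& 1 <= i, 1 <= a, a < b & b <= i.+1] ->
  orbit_mem n k.+1 i a b ->
  (1 < a -> ~~ orbit_mem n k.+1 i a.-1 b) ->
  (b <= i -> ~~ orbit_mem n k.+1 i a b.+1) ->
  (i.+1 < n -> ~~ orbit_mem n k.+1 i.+1 a b) ->
  [&& ~~ orbit_mem n k i a b,
      (a.+1 < b) ==> orbit_mem n k i a.+1 b,
      (a.+1 < b) ==> orbit_mem n k i a b.-1
    & (b <= i) ==> orbit_mem n k i.-1 a b].
Proof.
move=> ltk; case: i => // i; case: a => // a; case: b => // b /= lti abi.
rewrite /orbit_mem !(addSn, addnS) /= !negbK.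
case E : (odd _); have [h|h|h] := ltngtP (i + b).+2 (n + a).+1;
  have [h'|h'] := leqP b i; have [h2|h2] := leqP b a.+1; lia.
Qed.

(** * The orbit of the empty ideal *)

Section Tsscpp.
Variable n : nat.
Implicit Types x y : tsscpp n.

Definition layer x : nat := (tsscpp_val x).1.1.
Definition left_end x : nat := (tsscpp_val x).1.2.
Definition right_end x : nat := (tsscpp_val x).2.

Lemma tsscpp_bounds x :
  layer x < n /\
  [&& 1 <= layer x, 1 <= left_end x, left_end x < right_end x
    & right_end x <= (layer x).+1].
Proof. by case: x => [[[i a] b] xP]; split => //=; apply: ltn_ord. Qed.

Lemma tsscpp_exists i a b :
  i < n -> [&& 1 <= i, 1 <= a, a < b & b <= i.+1] ->
  exists x, [/\ layer x = i, left_end x = a & right_end x = b].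
Proof.
move=> lti abi.
have [lta ltb] : a < n.+1 /\ b < n.+1 by lia.
have xP : @tsscpp_triple n (Ordinal lti, Ordinal lta, Ordinal ltb) by [].
by exists (TSSCPP xP).
Qed.

Lemma tsscpp_coverE x y :
  tsscpp_cover x y =
  [&& layer x == layer y, 2 <= right_end y - left_end y
    & (left_end x == (left_end y).+1) && (right_end x == right_end y) ||
      (left_end x == left_end y) && (right_end x == (right_end y).-1)]
  || [&& layer y == (layer x).+1, left_end x == left_end y
       & right_end x == right_end y].
Proof. by case: x y => [[[i a] b] xP] [[[j c] e] yP]. Qed.

Lemma tsscpp_cover_lt x y : tsscpp_cover x y -> (x < y)%O.
Proof.
move=> cxy; rewrite lt_neqAle; apply/andP; split; last exact: connect1.
by apply/eqP => eq_xy; move: (tsscpp_cover_rk cxy); rewrite eq_xy ltnn.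
Qed.

Definition orbit_set k : {set tsscpp n} :=
  [set x | orbit_mem n k (layer x) (left_end x) (right_end x)].

Lemma orbit_set_ideal k : is_order_ideal (orbit_set k).
Proof.
apply: (@cover_closed_ideal _ _ (@tsscpp_cover n)) => // x y; rewrite !inE.
have [_] := tsscpp_bounds y; rewrite tsscpp_coverE.
(* The successor form lets the predecessor in the cover relation compute. *)
case: (right_end y) => [|b] /= yP; first by lia.
move=> /orP[/and3P[/eqP-> _ /orP[]]/andP[/eqP-> /eqP->]|].
- exact: orbit_mem_incr_a.
- exact: orbit_mem_decr_b.
- by move=> /and3P[/eqP-> /eqP-> /eqP->]; apply: orbit_mem_decr_i.
Qed.

Definition orbit_ideal k : order_ideal (tsscpp n) :=
  OrderIdeal (orbit_set_ideal k).

Lemma rowmotion_orbit_ideal k :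
  k.+1 < 3 * n - 2 ->
  rowmotion (tsscpp n) (orbit_ideal k) = orbit_ideal k.+1.
Proof.
move=> ltk; apply: (@rowmotionP _ _ (@tsscpp_cover n)) => //.
- exact: tsscpp_cover_lt.
- move=> x /=; have [lti xP] := tsscpp_bounds x; rewrite !inE => xI low.
  apply: orbit_mem_birth => // [lt|lt|lt].
  + have [|y [yi ya yb]] := @tsscpp_exists (layer x) (left_end x).+1 (right_end x) lti.
      by lia.
    by have := low y; rewrite tsscpp_coverE inE yi ya yb; apply; lia.
  + have [|y [yi ya yb]] := @tsscpp_exists (layer x) (left_end x) (right_end x).-1 lti.
      by lia.
    by have := low y; rewrite tsscpp_coverE inE yi ya yb; apply; lia.
  + have [||y [yi ya yb]] := @tsscpp_exists (layer x).-1 (left_end x) (right_end x).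
    * by lia.
    * by lia.
    by have := low y; rewrite tsscpp_coverE inE yi ya yb; apply; lia.
- move=> x /=; have [lti xP] := tsscpp_bounds x; rewrite !inE => xJ up.
  have [lt|lt|lt|] := and4P (orbit_mem_top ltk lti xP xJ _ _ _).
  + have [|y [yi ya yb]] := @tsscpp_exists (layer x) (left_end x).-1 (right_end x) lti.
      by lia.
    by have := up y; rewrite tsscpp_coverE inE yi ya yb; apply; lia.
  + have [|y [yi ya yb]] := @tsscpp_exists (layer x) (left_end x) (right_end x).+1 lti.
      by lia.
    by have := up y; rewrite tsscpp_coverE inE yi ya yb; apply; lia.
  + have [||y [yi ya yb]] := @tsscpp_exists (layer x).+1 (left_end x) (right_end x).
    * by lia.
    * by lia.
    by have := up y; rewrite tsscpp_coverE inE yi ya yb; apply; lia.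
  move=> xI inca decb deci; split => // y; have [_ yP] := tsscpp_bounds y.
  rewrite tsscpp_coverE inE.
  move=> /orP[/and3P[/eqP-> gap /orP[]]/andP[/eqP-> /eqP->]|].
  + by apply: (implyP inca); lia.
  + by apply: (implyP decb); lia.
  + move=> /and3P[/eqP eqi /eqP eqa /eqP eqb].
    rewrite eqi /= -eqa -eqb in deci; rewrite (implyP deci) //; lia.
Qed.

(** Since [a < b <= i + 1], one has [i + b >= 2b - 1 > 2a], which rules out the first alternative at
    [k = 0]. *)
Lemma orbit_ideal0 : orbit_ideal 0 = set0 :> {set _}.
Proof.
apply/setP => x; rewrite !inE; have [lti xP] := tsscpp_bounds x.
by rewrite /orbit_mem; lia.
Qed.

(** Both [i] and [b - a] are at most [n - 1], so [k = 3n - 3] meets the bound [n - 1 + i + (b - a)]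
    everywhere and the complement is empty. *)
Lemma rowmotion_orbit_ideal_last k :
  k.+1 = 3 * n - 2 -> rowmotion (tsscpp n) (orbit_ideal k) = orbit_ideal 0.
Proof.
move=> eqk; apply: val_inj; rewrite [RHS]orbit_ideal0; apply/setP => x.
rewrite !inE; apply/exists_inP => -[y]; rewrite !inE => /andP[yI _] _.
have [lti yP] := tsscpp_bounds y.
by move: yI; rewrite /orbit_mem; lia.
Qed.

Lemma iter_rowmotion_orbit k :
  k < 3 * n - 2 -> iter k (rowmotion (tsscpp n)) (orbit_ideal 0) = orbit_ideal k.
Proof.
elim: k => // k IHk ltk.
by rewrite iterS IHk ?rowmotion_orbit_ideal // ltnW.
Qed.

Lemma orbit_ideal_neq0 k :
  2 < n -> 0 < k < 3 * n - 2 -> orbit_ideal k != orbit_ideal 0.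
Proof.
move=> n3 kP; apply/eqP => /(congr1 ideal_set); rewrite orbit_ideal0 => /setP eq0.
(* [(1;1,2)] is present for every [k >= 1] except [k = n], where [(2;2,3)] is; for [n = 3] the
   parity clause admits the latter. *)
have [||x [xi xa xb]] := @tsscpp_exists 1 1 2 => //; first by lia.
have [//||y [yi ya yb]] := @tsscpp_exists 2 2 3 => //.
have := eq0 x; have := eq0 y; rewrite !inE xi xa xb yi ya yb /orbit_mem.
lia.
Qed.

End Tsscpp.

Theorem theorem8p19 (n : nat) (hn : 1 <= n) (hn2 : n != 2) :
  3 * n - 2 %| #[rowmotion_perm (tsscpp n)]%g.
Proof.
have [le1|n3] : n = 1 \/ 2 < n by lia.
  by rewrite le1 dvd1n.
have itE k I : iter k (rowmotion_perm (tsscpp n)) I = iter k (rowmotion (tsscpp n)) I.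
  by apply: eq_iter => J; rewrite permE.
apply: (@order_perm_dvdn _ _ (orbit_ideal n 0)) => [||k kP]; rewrite ?itE.
- by lia.
- have [m eqm] : exists m, m.+1 = 3 * n - 2 by exists (3 * n - 3); lia.
  rewrite -eqm iterS iter_rowmotion_orbit ?rowmotion_orbit_ideal_last //; lia.
- by rewrite iter_rowmotion_orbit ?orbit_ideal_neq0 //; case/andP: kP.
Qed.
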